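(* For every prime $p \equiv 11 \pmod{12}$ there is a symmetric subset $A \subset \mathbb{F}_p^2$ (i.e. $0 \notin A$ and $A = -A$) such that the Cayley graph $G = \operatorname{Cay}(\mathbb{F}_p^2, A)$ belongs to $\mathcal{W}_7$; that is, $G$ has diameter $2$, contains no triangle and no subgraph isomorphic to $K_{2,7}$, and is not a star.
   Context: All graphs are finite and simple. For an integer $t \ge 1$, $\mathcal{W}_t$ denotes the class of graphs other than stars (graphs $K_{1,m}$) that have diameter $2$ and contain neither a triangle $C_3$ nor a $K_{2,t}$ as a subgraph. For the additive group $\mathbb{F}_p^2$ and a symmetric set $A$, the Cayley graph $\operatorname{Cay}(\mathbb{F}_p^2, A)$ has vertex set $\mathbb{F}_p^2$, with $u, v$ adjacent iff $u - v \in A$. *)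

(* Defs.v *)
From HB Require Import structures.
From mathcomp Require Import all_boot all_order all_algebra.

Set Implicit Arguments.
Unset Strict Implicit.
Unset Printing Implicit Defensive.

Import GRing.Theory.

(* A finite graph is an adjacency relation on a finite type of vertices. *)
Definition simple_graph (T : finType) (e : rel T) : Prop :=
  symmetric e /\ irreflexive e.

(* Subgraph containment is not required to be induced. *)
Definition contains_subgraph (T U : finType) (e : rel T) (f : rel U) : Prop :=
  exists phi : U -> T, injective phi /\ {homo phi : x y / f x y >-> e x y}.

Definition graph_isomorphic (T U : finType) (e : rel T) (f : rel U) : Prop :=
  exists phi : U -> T, bijective phi /\ {mono phi : x y / f x y >-> e x y}.

(* This is the cycle C_n for n >= 3 only. *)
Definition cycle_graph (n : nat) : rel 'I_n :=
  fun i j => (j == ordS i) || (i == ordS j).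

Definition complete_bipartite (m n : nat) : rel ('I_m + 'I_n)%type :=
  fun x y => match x, y with
             | inl _, inr _ | inr _, inl _ => true
             | _, _ => false
             end.

Definition is_star (T : finType) (e : rel T) : Prop :=
  exists m : nat, graph_isomorphic e (@complete_bipartite 1 m).

(* No k satisfies this when x and y lie in different components. *)
Definition is_distance (T : finType) (e : rel T) (x y : T) (k : nat) : Prop :=
  (exists p : seq T, [/\ path e x p, last x p = y & size p = k]) /\
  (forall p : seq T, path e x p -> last x p = y -> k <= size p).

(* The maximum of the distances is d; in particular the graph is connected. *)
Definition has_diameter (T : finType) (e : rel T) (d : nat) : Prop :=
  (forall x y : T, exists2 k, is_distance e x y k & k <= d) /\
  (exists x y : T, is_distance e x y d).

Definition class_W (t : nat) (T : finType) (e : rel T) : Prop :=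
  [/\ simple_graph e,
      ~ is_star e,
      has_diameter e 2,
      ~ contains_subgraph e (@cycle_graph 3)
    & ~ contains_subgraph e (@complete_bipartite 2 t)].

Definition symmetric_subset (V : finZmodType) (A : {set V}) : Prop :=
  (0%R \notin A) /\ A = [set (- a)%R | a in A].

Definition Cay (V : finZmodType) (A : {set V}) : rel V :=
  fun u v => (u - v)%R \in A.

(* Main.v *)
Require Import Defs.
From mathcomp Require Import all_boot all_order all_algebra.
From mathcomp Require Import finfield ring.

Set Implicit Arguments.
Unset Strict Implicit.
Unset Printing Implicit Defensive.

Import GRing.Theory.

(** Take for [A] the two parabolas [y = x^2] and [y = - x^2] with the origin
    removed.  A triangle is a zero-sum triple of [A]; up to symmetry it yields
    [x + y = z], [x^2 + y^2 = z^2], hence [x y = 0], or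
    [x^2 + x y + y^2 = 0], hence a primitive cube root of unity, which does not
    exist since [p = 2] mod 3.  A vector [(a, b)] with [a != 0] is a difference
    of two points of [y = x^2], and [(0, b)] is the sum of [(x, y)] and [(- x, y)]
    for a suitable point of [A] because [b / 2] or [- b / 2] is a square when
    [p = 3] mod 4.  Finally a nonzero [d] is a sum of two
    points of the same parabola in at most 2 ordered ways, for each parabola,
    and a sum of points of distinct parabolas in at most 1 way for each order:
    at most 6 common neighbours. *)

(** * Diameter, stars and forbidden subgraphs, in terms of the connection set *)

Lemma has_diameter2 (T : finType) (e : rel T) :
    (forall x y, x != y -> ~~ e x y -> exists z, e x z /\ e z y) ->
    (exists x y, x != y /\ ~~ e x y) ->
  has_diameter e 2.
Proof.
move=> mid.
have dist2 x y : x != y -> ~~ e x y -> is_distance e x y 2.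
  move=> nxy nexy; split.
    by have [z [xz zy]] := mid x y nxy nexy; exists [:: z; y]; rewrite /= xz zy.
  case=> [|a [|b q]] //= => [_ xy|]; first by rewrite xy eqxx in nxy.
  by rewrite andbT => exa ay; rewrite -ay exa in nexy.
case=> x0 [y0 [n0 e0]]; split; last by exists x0, y0; apply: dist2.
move=> x y; have [->|nxy] := eqVneq x y.
  by exists 0 => //; split; first by exists [::].
have [exy|nexy] := boolP (e x y); last by exists 2 => //; apply: dist2.
exists 1 => //; split; first by exists [:: y]; rewrite /= exy.
by case=> //= _ xy; rewrite xy eqxx in nxy.
Qed.

Section CayleyGraphs.

Local Open Scope ring_scope.

Lemma symmetric_subsetN (V : finZmodType) (A : {set V}) (a : V) :
  symmetric_subset A -> (- a \in A) = (a \in A).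
Proof.
case=> _ eA; apply/idP/idP => aA; rewrite eA.
  by apply/imsetP; exists (- a); rewrite ?opprK.
by apply/imsetP; exists a.
Qed.

Lemma Cay_simple (V : finZmodType) (A : {set V}) :
  symmetric_subset A -> simple_graph (Cay A).
Proof.
move=> sA; split=> [u v | u]; last by rewrite /Cay subrr; apply: negbTE sA.1.
by rewrite /Cay -opprB symmetric_subsetN.
Qed.

(** If [c] were the centre of a star, [c + a] and [c + (a + a)] would both be leaves, yet they
    differ by [a] and so are adjacent. *)
Lemma Cay_not_star (V : finZmodType) (A : {set V}) (a : V) :
  symmetric_subset A -> a \in A -> a + a != 0 -> ~ is_star (Cay A).
Proof.
move=> [A0 _] aA aa0 [m [phi [[psi phiK psiK] mono]]].
pose c := phi (inl ord0).
have leaf x : x != 0 -> exists i, psi (c + x) = inr i.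
  case E: (psi (c + x)) => [i|i]; last by exists i.
  move=> /eqP[]; apply: (addrI c).
  by rewrite addr0 -[LHS]psiK E (ord1 i).
have a0 : a != 0 by apply: contraNneq A0 => <-.
have [i Ei] := leaf _ a0; have [j Ej] := leaf _ aa0.
have := mono (inr j) (inr i).
by rewrite /= -Ei -Ej !psiK /Cay addrA addrC addrK aA.
Qed.

(** The differences along the edges of a directed triangle telescope to zero. *)
Lemma Cay_C3_free (V : finZmodType) (A : {set V}) :
    (forall a b c, a \in A -> b \in A -> c \in A -> a + b + c != 0) ->
  ~ contains_subgraph (Cay A) (@cycle_graph 3).
Proof.
move=> sumfree [phi [_ homo]].
pose i1 : 'I_3 := Ordinal (isT : 1 < 3)%N.
have e01 := homo ord0 i1 isT.
have e12 := homo i1 ord_max isT.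
have e20 := homo ord_max ord0 isT.
have := sumfree _ _ _ e01 e12 e20.
by rewrite !addrA !subrK subrr eqxx.
Qed.

(** A common neighbour [w] of [u] and [v] splits [d = u - v] as [(u - w) + (w - v)], so [w] is
    determined by the summand [s = u - w]. *)
Lemma Cay_K2_free (V : finZmodType) (A : {set V}) (t : nat) :
    (forall d, d != 0 -> (#|[set s in A | (d - s)%R \in A]| < t)%N) ->
  ~ contains_subgraph (Cay A) (@complete_bipartite 2 t).
Proof.
move=> few [phi [inj homo]].
pose u := phi (inl ord0); pose v := phi (inl ord_max).
have d0 : u - v != 0 by rewrite subr_eq0; apply/eqP => /inj.
pose f i := u - phi (inr i).
have f_inj : injective f.
  by move=> i j /(addrI u)/oppr_inj/inj[].
have := few _ d0; rewrite ltnNge => /negP[].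
rewrite -[leqLHS]card_ord -cardsT -(card_imset _ f_inj).
apply/subset_leq_card/subsetP => _ /imsetP[i _ ->].
rewrite inE; apply/andP; split; first exact: homo (inl ord0) (inr i) isT.
rewrite /f.
have -> : u - v - (u - phi (inr i)) = phi (inr i) - v.
  by rewrite opprB addrC addrA subrK.
exact: homo (inr i) (inl ord_max) isT.
Qed.

End CayleyGraphs.

(** * The two punctured parabolas over a finite field *)

Section TwoParabolas.

Local Open Scope ring_scope.

Variable F : finFieldType.
Implicit Types (v d s : 'rV[F]_2) (c e x y : F).

Lemma row2P v d : v 0 0 = d 0 0 -> v 0 1 = d 0 1 -> v = d.
Proof.
move=> e0 e1; apply/rowP; case=> [[|[|//]] i2].
  by have -> : Ordinal i2 = 0 by apply: val_inj.
by have -> : Ordinal i2 = 1 by apply: val_inj.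
Qed.

Definition vec2 x y : 'rV[F]_2 := \row_j (if j == 0 then x else y).

Lemma vec2_0 x y : vec2 x y 0 0 = x.
Proof. by rewrite mxE. Qed.

Lemma vec2_1 x y : vec2 x y 0 1 = y.
Proof. by rewrite mxE. Qed.

Definition parabola e : {set 'rV[F]_2} := [set v : 'rV[F]_2 | v 0 1 == e * v 0 0 ^+ 2].

(** On either parabola only the origin has first coordinate 0. *)
Definition two_parabolas : {set 'rV[F]_2} :=
  [set v : 'rV[F]_2 in parabola 1 :|: parabola (- 1) | v 0 0 != 0].

Lemma two_parabolasP v :
  reflect (v 0 0 != 0 /\ exists2 e, e = 1 \/ e = - 1 & v 0 1 = e * v 0 0 ^+ 2)
          (v \in two_parabolas).
Proof.
rewrite !inE; apply: (iffP andP) => [[/orP[] /eqP ve v0]|].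
- by split=> //; exists 1; first by left.
- by split=> //; exists (- 1); first by right.
by case=> v0 [e [] -> ->]; rewrite eqxx ?orbT.
Qed.

Lemma two_parabolas_symmetric : symmetric_subset two_parabolas.
Proof.
have oppA v : v \in two_parabolas -> - v \in two_parabolas.
  case/two_parabolasP=> v0 [e e1 ve]; apply/two_parabolasP; split.
    by rewrite mxE oppr_eq0.
  (* Negation swaps the two parabolas. *)
  exists (- e); first by case: e1 => ->; rewrite ?opprK; [right | left].
  by rewrite !mxE ve; ring.
split; first by rewrite !inE !mxE eqxx andbF.
apply/setP => v; apply/idP/imsetP => [vA | [w wA ->]]; last exact: oppA.
by exists (- v); rewrite ?opprK ?oppA.
Qed.

Hypothesis two_neq0 : 2%:R != 0 :> F.

Lemma two_parabolas_sumfree u v w :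
    (forall x y, x ^+ 2 + x * y + y ^+ 2 = 0 -> x = 0) ->
    u \in two_parabolas -> v \in two_parabolas -> w \in two_parabolas ->
  u + v + w != 0.
Proof.
move=> cub /two_parabolasP[u0 [e1 e1E ue]] /two_parabolasP[v0 [e2 e2E ve]].
case/two_parabolasP=> w0 [e3 e3E we]; apply/eqP => /rowP sum0.
have := sum0 1; have := sum0 0; rewrite !mxE ue ve we.
move: (u 0 0) (v 0 0) (w 0 0) u0 v0 w0 => x y z x0 y0 z0 {sum0 ue ve we}.
move/eqP; rewrite addr_eq0 => /eqP zE.
have prod0 (a b : F) : a != 0 -> b != 0 -> 2%:R * (a * b) != 0.
  by move=> a0 b0; do 2!apply: mulf_neq0 => //.
have xy0 : x ^+ 2 + x * y + y ^+ 2 != 0 by apply: contra_neq x0 => /cub.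
have {zE} zE : z = - (x + y) by rewrite zE opprK.
rewrite zE in z0 *.
have xy := prod0 _ _ x0 y0; have xz := prod0 _ _ x0 z0.
have yz := prod0 _ _ y0 z0; have q := mulf_neq0 two_neq0 xy0.
(* With [z = - (x + y)], the second coordinate of the sum is, up to sign, [2 (x^2 + x y + y^2)] when
   all three signs agree; otherwise it is twice the product of the two coordinates whose signs
   agree. *)
case: e1E => ->; case: e2E => ->; case: e3E => -> /eqP; apply/negP.
- by apply: contra q => /eqP <-; apply/eqP; ring.
- by apply: contra xy; rewrite -oppr_eq0 => /eqP <-; apply/eqP; ring.
- by apply: contra xz; rewrite -oppr_eq0 => /eqP <-; apply/eqP; ring.
- by apply: contra yz => /eqP <-; apply/eqP; ring.
- by apply: contra yz; rewrite -oppr_eq0 => /eqP <-; apply/eqP; ring.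
- by apply: contra xz => /eqP <-; apply/eqP; ring.
- by apply: contra xy => /eqP <-; apply/eqP; ring.
- by apply: contra q; rewrite -oppr_eq0 => /eqP <-; apply/eqP; ring.
Qed.

Lemma two_parabolas_cover d :
    (forall c, exists x, x ^+ 2 = c \/ x ^+ 2 = - c) ->
    d != 0 -> d \notin two_parabolas ->
  exists2 s, s \in two_parabolas & d - s \in two_parabolas.
Proof.
move=> sqr d0 dA; set a := d 0 0; set b := d 0 1.
have [a0|a0] := eqVneq a 0.
  have b0 : b != 0.
    by apply: contra_neq d0 => b0; apply: row2P; rewrite mxE.
  have [x xE] := sqr (b / 2%:R).
  have x0 : x != 0.
    apply: contraNneq (mulf_neq0 b0 (invr_neq0 two_neq0)) => x0.
    by case: xE => /esym/eqP; rewrite x0 expr0n ?oppr_eq0.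
  have [e e1 eE] : exists2 e, e = 1 \/ e = - 1 & b / 2%:R = e * x ^+ 2.
    case: xE => ->; first by exists 1; rewrite ?mul1r; first left.
    by exists (- 1); rewrite ?mulN1r ?opprK; first right.
  exists (vec2 x (b / 2%:R)); apply/two_parabolasP.
    by rewrite vec2_0 vec2_1; split=> //; exists e.
  have -> : d - vec2 x (b / 2%:R) = vec2 (- x) (b / 2%:R).
    apply: row2P; rewrite [LHS]mxE [X in _ + X]mxE ?vec2_0 ?vec2_1 -/a -/b.
      by rewrite a0 add0r.
    by field.
  by rewrite vec2_0 vec2_1 oppr_eq0 sqrrN; split=> //; exists e.
(* The solution of [x + y = a], [x^2 - y^2 = b]. If [x] or [y] vanishes, then [b = - a^2] or
   [b = a^2], and [d] already lies in the set. *)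
pose x := (b / a + a) / 2%:R; pose y := (a - b / a) / 2%:R.
have x0 : x != 0.
  apply: contraNneq dA => xE; apply/two_parabolasP; split=> //.
  exists (- 1); first by right.
  have -> : d 0 1 = 2%:R * a * x - a ^+ 2 by rewrite /x -/b; field; apply/andP.
  by rewrite xE -/a; ring.
have y0 : y != 0.
  apply: contraNneq dA => yE; apply/two_parabolasP; split=> //.
  exists 1; first by left.
  have -> : d 0 1 = a ^+ 2 - 2%:R * a * y by rewrite /y -/b; field; apply/andP.
  by rewrite yE -/a; ring.
exists (vec2 x (x ^+ 2)); apply/two_parabolasP.
  by rewrite vec2_0 vec2_1; split=> //; exists 1; rewrite ?mul1r; first left.
have -> : d - vec2 x (x ^+ 2) = vec2 y (- y ^+ 2).
  by apply: row2P; rewrite [LHS]mxE [X in _ + X]mxE ?vec2_0 ?vec2_1 -/a -/b /x /y;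
    field; apply/andP.
by rewrite vec2_0 vec2_1; split=> //; exists (- 1); rewrite ?mulN1r; first right.
Qed.

(** The first coordinate of [s] is a root of a quadratic; given one solution [s], the other root
    belongs to [d - s]. *)
Lemma card_parabola_same d e : e != 0 ->
  (#|[set s in parabola e | (d - s)%R \in parabola e]| <= 2)%N.
Proof.
move=> e0; set S := [set _ in _ | _].
have [->|[s sS]] := set_0Vmem S; first by rewrite cards0.
suff /subset_leq_card/leq_trans : S \subset [set s; d - s].
  by apply; rewrite cards2; case: (_ != _).
apply/subsetP => t; move: sS; rewrite !inE !mxE.
set x := s 0 0; set y := t 0 0; set a := d 0 0.
move=> /andP[/eqP sE /eqP dsE] /andP[/eqP tE /eqP dtE].
have : 2%:R * e * ((y - x) * (y - (a - x))) = 0.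
  have -> : 2%:R * e * ((y - x) * (y - (a - x))) =
      (e * y ^+ 2 + e * (a - y) ^+ 2) - (e * x ^+ 2 + e * (a - x) ^+ 2) by ring.
  by rewrite -dsE -dtE -sE -tE; ring.
move/eqP; rewrite !mulf_eq0 (negbTE e0) (negbTE two_neq0) /= !subr_eq0.
case/orP=> /eqP yE; apply/orP; [left | right]; apply/eqP/row2P => //.
- by rewrite sE tE -/x -/y yE.
- by rewrite !mxE.
- by rewrite !mxE dsE tE -/y yE.
Qed.

(** The quadratic terms cancel: [b = e a (2 x - a)] is linear in [x], and [a = 0] would force
    [b = 0], hence [d = 0]. *)
Lemma card_parabola_opp d e : e != 0 -> d != 0 ->
  (#|[set s in parabola e | (d - s)%R \in parabola (- e)%R]| <= 1)%N.
Proof.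
move=> e0 d0; apply/card_le1P => s; rewrite !inE !mxE => /andP[/eqP sE /eqP dsE] t.
rewrite !inE !mxE; apply/idP/eqP => [/andP[/eqP tE /eqP dtE]|->]; last first.
  by rewrite dsE sE !eqxx.
move: sE dsE tE dtE; set x := s 0 0; set y := t 0 0; set a := d 0 0; set b := d 0 1.
move=> sE dsE tE dtE.
have bE : b = e * a * (2%:R * x - a).
  by rewrite -(subrK (s 0 1) b) dsE sE; ring.
have a0 : a != 0.
  apply: contra_neq d0 => a0; apply: row2P; rewrite mxE // -/b bE a0.
  by rewrite mulr0 mul0r.
have yx : 2%:R * e * a * (y - x) = 0.
  have -> : 2%:R * e * a * (y - x) = e * a * (2%:R * y - a) - b by rewrite bE; ring.
  by rewrite -(subrK (t 0 1) b) dtE tE; ring.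
move/eqP: yx; rewrite !mulf_eq0 (negbTE e0) (negbTE a0) (negbTE two_neq0) /=.
rewrite subr_eq0 => /eqP yE.
by apply: row2P => //; rewrite sE tE yE.
Qed.

Lemma card_two_parabolas_reps d : d != 0 ->
  (#|[set s in two_parabolas | (d - s)%R \in two_parabolas]| < 7)%N.
Proof.
move=> d0.
pose R e f := [set s in parabola e | (d - s)%R \in parabola f].
have n1 : 1 != 0 :> F := oner_neq0 F.
have nN1 : - 1 != 0 :> F by rewrite oppr_eq0.
have same e : e != 0 -> (#|R e e| <= 2)%N by apply: card_parabola_same.
have opp e : e != 0 -> (#|R e (- e)%R| <= 1)%N by move/card_parabola_opp; apply.
have oppN1 : (#|R (- 1)%R 1%R| <= 1)%N by have := opp _ nN1; rewrite opprK.
(* [U] allows the whole parabolas, origin included; its four pieces have at most 2, 2, 1 and 1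
   elements. *)
pose U := (R 1 1 :|: R (- 1) (- 1)) :|: (R 1 (- 1) :|: R (- 1) 1).
have sub : [set s in two_parabolas | d - s \in two_parabolas] \subset U.
  apply/subsetP => s; rewrite /U /R !inE.
  by case/andP=> /andP[/orP[] -> _] /andP[/orP[] -> _]; rewrite ?orbT.
apply: leq_ltn_trans (subset_leq_card sub) _; rewrite ltnS.
have cardU_le (B C : {set 'rV[F]_2}) m n :
    (#|B| <= m)%N -> (#|C| <= n)%N -> (#|B :|: C| <= m + n)%N.
  by move=> Bm Cn; apply: leq_trans (leq_card_setU _ _) (leq_add Bm Cn).
apply: (cardU_le _ _ 4 2); first by apply: (cardU_le _ _ 2 2); apply: same.
by apply: (cardU_le _ _ 1 1) => //; apply: opp.
Qed.

Lemma Cay_two_parabolas_W7 :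
    (forall x y, x ^+ 2 + x * y + y ^+ 2 = 0 -> x = 0) ->
    (forall c, exists x, x ^+ 2 = c \/ x ^+ 2 = - c) ->
  class_W 7 (Cay two_parabolas).
Proof.
move=> cub sqr; have sA := two_parabolas_symmetric; split.
- exact: Cay_simple.
- apply: (@Cay_not_star _ _ (vec2 1 1)) => //.
    apply/two_parabolasP; rewrite vec2_0 vec2_1 oner_neq0; split=> //.
    by exists 1; rewrite ?mul1r ?expr1n; first left.
  by apply: contra_neq two_neq0 => /rowP/(_ 0); rewrite !mxE.
- apply: has_diameter2 => [u v nuv nA | ].
    have uv0 : u - v != 0 by rewrite subr_eq0.
    have [s sA1 sA2] := two_parabolas_cover sqr uv0 nA.
    by exists (u - s); rewrite /Cay opprB addrC subrK addrAC.
  (* Nonadjacent, as the difference has first coordinate 0. *)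
  exists (vec2 0 1), 0; split; last first.
    by rewrite /Cay subr0; apply/two_parabolasP; rewrite vec2_0 eqxx; case.
  by apply/eqP => /rowP/(_ 1)/eqP; rewrite vec2_1 mxE oner_eq0.
- by apply: Cay_C3_free => a b c; apply: two_parabolas_sumfree.
- by apply: Cay_K2_free => d; apply: card_two_parabolas_reps.
Qed.

End TwoParabolas.

(** * Squares and cubes in finite fields *)

Section FiniteFields.

Local Open Scope ring_scope.

Variable F : finFieldType.

(** With [q = #|F|], the element [x = c^((q + 1) / 4)] satisfies [x^4 = c^(q + 1) = c^2], so [x^2]
    is [c] or [- c]. *)
Lemma finField_sqr_or_opp_sqr (k : nat) (c : F) : #|F| = (4 * k + 3)%N ->
  exists x, x ^+ 2 = c \/ x ^+ 2 = - c.
Proof.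
move=> cardF; exists (c ^+ k.+1).
have : ((c ^+ k.+1) ^+ 2) ^+ 2 == c ^+ 2.
  rewrite -!exprM; have -> : (k.+1 * (2 * 2) = #|F|.+1)%N by rewrite cardF; ring.
  by rewrite exprS expf_card.
by rewrite eqf_sqr => /orP[] /eqP; [left | right].
Qed.

(** The form divides [x^3 - y^3], so a zero of it has [x^3 = y^3]; injectivity of cubing gives
    [x = y], and the form becomes [3 x^2]. *)
Lemma finField_cyclotomic3_anisotropic (k : nat) (x y : F) :
    #|F| = (3 * k + 2)%N -> 3%:R != 0 :> F ->
  x ^+ 2 + x * y + y ^+ 2 = 0 -> x = 0.
Proof.
move=> cardF n3 xy0.
have cube : x ^+ 3 = y ^+ 3.
  apply/eqP; rewrite -subr_eq0; apply/eqP.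
  have -> : x ^+ 3 - y ^+ 3 = (x - y) * (x ^+ 2 + x * y + y ^+ 2) by ring.
  by rewrite xy0 mulr0.
(* Cubing is injective because 3 is coprime to [#|F| - 1 = 3 k + 1]: here
   [z ^ (2 #|F| - 1) = z ^ (3 (2 k + 1))] recovers [z]. *)
have recover z : (z ^+ 3) ^+ (2 * k).+1 = z :> F.
  rewrite -exprM.
  have [->|z0] := eqVneq z 0; first by rewrite expr0n.
  apply: (mulfI z0); rewrite -exprS.
  have -> : ((3 * (2 * k).+1).+1 = #|F| * 2)%N by rewrite cardF; ring.
  by rewrite exprM expf_card.
have xy : x = y by rewrite -(recover x) cube recover.
move/eqP: xy0; rewrite -xy.
have -> : x ^+ 2 + x * x + x ^+ 2 = 3%:R * x ^+ 2 by ring.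
by rewrite mulf_eq0 (negbTE n3) expf_eq0 /= => /eqP.
Qed.

End FiniteFields.

Theorem theorem1p4 (p : nat) (p_prime : prime p) (p_mod12 : p = 11 %[mod 12]) :
  exists A : {set 'rV['F_p]_2}, symmetric_subset A /\ class_W 7 (Cay A).
Proof.
pose m := p %/ 12.
have pE : p = 12 * m + 11 by rewrite {1}(divn_eq p 12) p_mod12 mulnC.
have natF_neq0 n : 0 < n < p -> (n%:R != 0 :> 'F_p)%R.
  by case/andP=> n0 np; rewrite -(dvdn_pcharf (pchar_Fp p_prime)) gtnNdvd.
have le11p : 11 <= p by rewrite pE leq_addl.
exists (two_parabolas 'F_p); split; first exact: two_parabolas_symmetric.
(* Here [p = 12 m + 11] is read as [3 (4 m + 3) + 2] and as [4 (3 m + 2) + 3]; since [p] is at least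
   11, 2 and 3 are nonzero in ['F_p]. *)
apply: Cay_two_parabolas_W7 => [|x y|c].
- by apply: natF_neq0; apply: leq_trans le11p.
- apply: (@finField_cyclotomic3_anisotropic _ (4 * m + 3)).
    by rewrite card_Fp // pE; ring.
  by apply: natF_neq0; apply: leq_trans le11p.
apply: (@finField_sqr_or_opp_sqr _ (3 * m + 2)).
by rewrite card_Fp // pE; ring.
Qed.
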